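(* Let $\phi_1:Q_1\to X_1$, $\phi_2:Q_2\to X_2$, $\sigma:Q_2\to Q_1$ and $\psi:X_1\to X_2$ be quandle homomorphisms such that $\psi\circ\phi_1\circ\sigma=\phi_2$. Let $A_i$ be an abelian $X_i$-quandle for $i=1,2$. If $\tau:A_1\to A_2$ is an $X_1$-homomorphism (where $A_2$ is regarded as an $X_1$-quandle via $\psi$), then there exist quandle homomorphisms $$\Phi:\operatorname{Der}_{\phi_1}(Q_1,A_1)\to\operatorname{Der}_{\phi_2}(Q_2,A_2),$$ $$\tilde\Phi:\operatorname{Hom}_{X_1}(\mathcal{A}_{\phi_1},A_1)\to\operatorname{Hom}_{X_2}(\mathcal{A}_{\phi_2},A_2)$$ such that, further, if $\psi$, $\sigma$ and $\tau$ are isomorphisms, then so are $\Phi$ and $\tilde\Phi$.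
   Context: A quandle is a non-empty set $Q$ with a binary operation $*$ such that (Q1) $q*q=q$ for all $q$; (Q2) for all $q_1,q_2\in Q$ there is a unique $q\in Q$ with $q_2=q*q_1$; (Q3) $(q_1*q_2)*q_3=(q_1*q_3)*(q_2*q_3)$ for all $q_1,q_2,q_3$. A quandle homomorphism is a map $f$ with $f(q_1*q_2)=f(q_1)*f(q_2)$. A quandle $A$ is abelian if $(x*y)*(z*w)=(x*z)*(y*w)$ for all $x,y,z,w\in A$. The associated group $\operatorname{As}(Q)$ is the group generated by $\{e_q \mid q\in Q\}$ modulo the relations $e_{q_1*q_2}=e_{q_2}e_{q_1}e_{q_2}^{-1}$. A quandle homomorphism $\phi:Q\to Q'$ induces a group homomorphism $\phi:\operatorname{As}(Q)\to\operatorname{As}(Q')$, $\phi(e_q)=e_{\phi(q)}$. A quandle $A$ is a $Q'$-quandle if it is equipped with a (left) action $(g,a)\mapsto g\cdot a$ of $\operatorname{As}(Q')$ on $A$ by quandle automorphisms; every $Q'$-quandle is then a $Q$-quandle via the induced map $\phi:\operatorname{As}(Q)\to\operatorname{As}(Q')$. A $Q'$-homomorphism between $Q'$-quandles is a quandle homomorphism commuting with the actions of $\operatorname{As}(Q')$; $\operatorname{Hom}_{Q'}(A_1,A_2)$ is the set of these. Given $\phi:Q\to Q'$ and a $Q'$-quandle $A$, a derivation is a map $\partial:Q\to A$ with $\partial(q_1*q_2)=\partial(q_1)*\big(\phi(e_{q_1})\cdot\partial(q_2)\big)$ for all $q_1,q_2\in Q$; $\operatorname{Der}_\phi(Q,A)$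 is the set of all derivations. When $A$ is abelian it carries the operation $(f*g)(q)=f(q)*g(q)$. The derived quandle $\mathcal{A}_\phi$ of $\phi:Q\to Q'$ is the quandle with generating set $\operatorname{As}(Q')\times Q$ and relations $(g,q_1*q_2)=(g,q_1)*(g\phi(e_{q_1}),q_2)$ for $q_1,q_2\in Q$, $g\in\operatorname{As}(Q')$; it is a $Q'$-quandle via $g'\cdot(g,q)=(g'g,q)$, and $\partial(q)=(1,q)$ is a derivation $Q\to \mathcal{A}_\phi$ which is universal: every derivation $\partial':Q\to A$ to a $Q'$-quandle factors as $\partial'=\lambda\circ\partial$ for a unique $Q'$-homomorphism $\lambda:\mathcal{A}_\phi\to A$. When $A$ is abelian, $\operatorname{Hom}_{Q'}(\mathcal{A}_\phi,A)$ carries the operation determined on generators by $(\lambda_1*\lambda_2)((g,q))=\lambda_1((g,q))*\lambda_2((g,q))$. The sets $\operatorname{Der}$ and $\operatorname{Hom}$ are quandles when non-empty; if some of them are empty, ''quandle homomorphism'' (isomorphism) between them means an operation-preserving (bijective) map between possibly empty sets. *)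

(* Defs.v *)
From HB Require Import structures.
#[warning="-notation-overridden"] From mathcomp Require Import all_boot.
From mathcomp Require Import boolp.

Set Implicit Arguments.
Unset Strict Implicit.
Unset Printing Implicit Defensive.

Local Open Scope group_scope.
Local Open Scope quotient_scope.

(* A quandle homomorphism is a multiplicative map [{multiplicative Q -> Q'}],
   the quandle operation being written [x * y]. *)
HB.mixin Record Magma_isQuandle Q of Magma Q := {
  quandle_inhabited : inhabited Q;
  mulqq : forall q : Q, q * q = q;
  mulq_exists1 : forall q1 q2 : Q, exists! q : Q, q2 = q * q1;
  mulqDl : forall q1 q2 q3 : Q, (q1 * q2) * q3 = (q1 * q3) * (q2 * q3)
}.

#[short(type="quandleType")]
HB.structure Definition Quandle := {Q of Magma_isQuandle Q & Magma Q}.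

HB.mixin Record Quandle_isAbelian A of Quandle A := {
  mulqACA : forall x y z w : A, (x * y) * (z * w) = (x * z) * (y * w)
}.

#[short(type="abelianQuandleType")]
HB.structure Definition AbelianQuandle := {A of Quandle_isAbelian A & Quandle A}.

Inductive gterm (S : Type) : Type :=
  | GGen of S
  | GOne
  | GMul of gterm S & gterm S
  | GInv of gterm S.

Arguments GOne {S}.

(* The least congruence containing [R] whose quotient is a group. *)
Inductive gcong (S : Type) (R : gterm S -> gterm S -> Prop) :
    gterm S -> gterm S -> Prop :=
  | gcong_rel t u : R t u -> gcong R t u
  | gcong_refl t : gcong R t t
  | gcong_sym t u : gcong R t u -> gcong R u t
  | gcong_trans t u v : gcong R t u -> gcong R u v -> gcong R t v
  | gcong_mul t t' u u' :
      gcong R t t' -> gcong R u u' -> gcong R (GMul t u) (GMul t' u')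
  | gcong_inv t t' : gcong R t t' -> gcong R (GInv t) (GInv t')
  | gcong_mulA t u v : gcong R (GMul t (GMul u v)) (GMul (GMul t u) v)
  | gcong_mul1 t : gcong R (GMul GOne t) t
  | gcong_mulr1 t : gcong R (GMul t GOne) t
  | gcong_mulV t : gcong R (GMul (GInv t) t) GOne
  | gcong_mulrV t : gcong R (GMul t (GInv t)) GOne.

Section PresentedGroup.
Variables (S : Type) (R : gterm S -> gterm S -> Prop).

Definition gcongb : rel {classic gterm S} := fun t u => `[< gcong R t u >].

Lemma gcongb_equiv : equiv_class_of gcongb.
Proof.
split=> [t|t u|u t v].
- exact/asboolP/gcong_refl.
- by apply/asboolP/asboolP; apply: gcong_sym.
- by move=> /asboolP tu /asboolP uv; apply/asboolP/(gcong_trans tu uv).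
Qed.

Canonical gcongb_equiv_rel := EquivRelPack gcongb_equiv.

Definition presG : Type := {eq_quot gcongb}.

HB.instance Definition _ := Choice.copy presG {eq_quot gcongb}.
HB.instance Definition _ := Quotient.copy presG {eq_quot gcongb}.

Lemma presG_eqP (t u : gterm S) :
  \pi_presG t = \pi_presG u <-> gcong R t u.
Proof.
split=> [/(@eqmodP _ _ _)/asboolP|tu] //.
exact/eqmodP/asboolP.
Qed.

Definition presG_one : presG := \pi_presG GOne.
Definition presG_mul (x y : presG) : presG :=
  \pi_presG (GMul (repr x) (repr y)).
Definition presG_inv (x : presG) : presG := \pi_presG (GInv (repr x)).

Lemma presG_repr (t : gterm S) : gcong R (repr (\pi_presG t)) t.
Proof. by apply/presG_eqP; rewrite reprK. Qed.

Lemma presG_mulE (t u : gterm S) :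
  presG_mul (\pi_presG t) (\pi_presG u) = \pi_presG (GMul t u).
Proof. by apply/presG_eqP/gcong_mul; exact: presG_repr. Qed.

Lemma presG_invE (t : gterm S) : presG_inv (\pi_presG t) = \pi_presG (GInv t).
Proof. by apply/presG_eqP/gcong_inv; exact: presG_repr. Qed.

Lemma presG_mulA : associative presG_mul.
Proof.
elim/quotW=> t; elim/quotW=> u; elim/quotW=> v.
rewrite (presG_mulE t u) (presG_mulE u v) (presG_mulE t) presG_mulE.
exact/presG_eqP/gcong_mulA.
Qed.

Lemma presG_mul1 : left_id presG_one presG_mul.
Proof. by elim/quotW=> t; rewrite presG_mulE; apply/presG_eqP/gcong_mul1. Qed.

Lemma presG_mulr1 : right_id presG_one presG_mul.
Proof. by elim/quotW=> t; rewrite presG_mulE; apply/presG_eqP/gcong_mulr1. Qed.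

Lemma presG_mulV : left_inverse presG_one presG_inv presG_mul.
Proof.
by elim/quotW=> t; rewrite presG_invE presG_mulE; apply/presG_eqP/gcong_mulV.
Qed.

Lemma presG_mulrV : right_inverse presG_one presG_inv presG_mul.
Proof.
by elim/quotW=> t; rewrite presG_invE presG_mulE; apply/presG_eqP/gcong_mulrV.
Qed.

HB.instance Definition _ :=
  isGroup.Build presG
    presG_mulA presG_mul1 presG_mulr1 presG_mulV presG_mulrV.

Section Lift.
Variables (G : groupType) (f : S -> G).

Fixpoint geval (t : gterm S) : G :=
  match t with
  | GGen s => f s
  | GOne => 1
  | GMul t u => geval t * geval u
  | GInv t => (geval t)^-1
  end.

Definition presG_lift (x : presG) : G := geval (repr x).

Hypothesis fR : forall t u, R t u -> geval t = geval u.

Lemma geval_cong t u : gcong R t u -> geval t = geval u.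
Proof.
elim=> //= {t u}.
- by move=> t u v _ -> _ ->.
- by move=> t t' u u' _ -> _ ->.
- by move=> t t' _ ->.
- by move=> t u v; rewrite mulgA.
- by move=> t; rewrite mul1g.
- by move=> t; rewrite mulg1.
- by move=> t; rewrite mulVg.
- by move=> t; rewrite mulgV.
Qed.

Lemma presG_liftE (t : gterm S) : presG_lift (\pi_presG t) = geval t.
Proof. exact/geval_cong/presG_repr. Qed.

Lemma presG_liftM : {morph presG_lift : x y / x * y}.
Proof.
elim/quotW=> t; elim/quotW=> u.
by rewrite [_ * _ in LHS]presG_mulE !presG_liftE.
Qed.

End Lift.
End PresentedGroup.

Inductive as_rel (Q : quandleType) : gterm Q -> gterm Q -> Prop :=
  | AsRel (q1 q2 : Q) :
      as_rel (GGen (q1 * q2))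
             (GMul (GMul (GGen q2) (GGen q1)) (GInv (GGen q2))).

Definition As (Q : quandleType) : Type := presG (@as_rel Q).
HB.instance Definition _ (Q : quandleType) := Group.on (As Q).

Definition as_gen (Q : quandleType) (q : Q) : As Q := \pi_(As Q) (GGen q).

Lemma as_genM (Q : quandleType) (q1 q2 : Q) :
  as_gen (q1 * q2) = as_gen q2 * as_gen q1 * (as_gen q2)^-1.
Proof.
transitivity (\pi_(As Q) (GMul (GMul (GGen q2) (GGen q1)) (GInv (GGen q2)))).
  exact/presG_eqP/gcong_rel/AsRel.
by rewrite -presG_mulE -presG_mulE -presG_invE.
Qed.

Section AsMap.
Variables (Q Q' : quandleType) (phi : {multiplicative Q -> Q'}).

Definition as_map : As Q -> As Q' :=
  presG_lift (fun q => as_gen (phi q)).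

Lemma as_map_rel (t u : gterm Q) : as_rel t u ->
  geval (fun q => as_gen (phi q)) t = geval (fun q => as_gen (phi q)) u.
Proof. by case=> q1 q2 /=; rewrite gmulfM as_genM. Qed.

Lemma as_mapE (q : Q) : as_map (as_gen q) = as_gen (phi q).
Proof. exact: (presG_liftE as_map_rel). Qed.

Lemma as_mapM : {morph as_map : x y / x * y}.
Proof. exact: (presG_liftM as_map_rel). Qed.

Lemma as_map1 : as_map 1 = 1.
Proof. exact: (presG_liftE as_map_rel GOne). Qed.

HB.instance Definition _ := isMultiplicative.Build (As Q) (As Q') as_map as_mapM.
HB.instance Definition _ :=
  Multiplicative_isUMagmaMorphism.Build (As Q) (As Q') as_map as_map1.

End AsMap.

Lemma as_gen_ind (Q : quandleType) (P : As Q -> Prop) :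
  (forall q, P (as_gen q)) -> P 1 ->
  (forall x y, P x -> P y -> P (x * y)) -> (forall x, P x -> P x^-1) ->
  forall x, P x.
Proof.
move=> Pgen P1 PM PV; elim/quotW; elim=> [q||t Pt u Pu|t Pt]; last 2 first.
- by have := PM _ _ Pt Pu; rewrite [_ * _]presG_mulE.
- by have := PV _ Pt; rewrite [_^-1]presG_invE.
- exact: Pgen.
- exact: P1.
Qed.

(* The maps [act g] are bijective by [act1] and [actM], so that [actMq] makes
   them quandle automorphisms. *)
HB.mixin Record Quandle_isXQuandle (X : quandleType) A of Quandle A := {
  act : As X -> A -> A;
  act1 : forall a, act 1 a = a;
  actM : forall g h a, act (g * h) a = act g (act h a);
  actMq : forall g, {morph act g : a b / a * b}
}.

#[short(type="xquandleType")]
HB.structure Definition XQuandle (X : quandleType) :=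
  {A of Quandle_isXQuandle X A & Quandle A}.

#[short(type="abelianXQuandleType")]
HB.structure Definition AbelianXQuandle (X : quandleType) :=
  {A of AbelianQuandle A & XQuandle X A}.

Arguments act {X A} : rename.

(* [restrict psi A] is the [Y]-quandle [A] regarded as an [X]-quandle via
   [psi : X -> Y]. *)
Definition restrict (X Y : quandleType) (psi : {multiplicative X -> Y})
  (A : Type) : Type := A.

Section Restrict.
Variables (X Y : quandleType) (psi : {multiplicative X -> Y}).
Variable (A : xquandleType Y).

HB.instance Definition _ := Quandle.copy (restrict psi A) A.

Definition restrict_act (g : As X) (a : restrict psi A) : restrict psi A :=
  act (as_map psi g) (a : A).

Lemma restrict_act1 a : restrict_act 1 a = a.
Proof. by rewrite /restrict_act gmulf1 act1. Qed.

Lemma restrict_actM g h a :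
  restrict_act (g * h) a = restrict_act g (restrict_act h a).
Proof. by rewrite /restrict_act gmulfM actM. Qed.

Lemma restrict_actMq g : {morph restrict_act g : a b / a * b}.
Proof. exact: actMq. Qed.

HB.instance Definition _ :=
  Quandle_isXQuandle.Build X (restrict psi A)
    restrict_act1 restrict_actM restrict_actMq.

End Restrict.

Record xhom (X : quandleType) (A B : xquandleType X) := XHom {
  xhom_fun :> A -> B;
  xhomM : {morph xhom_fun : a b / a * b};
  xhomJ : forall (g : As X) (a : A), xhom_fun (act g a) = act g (xhom_fun a)
}.

Lemma xhom_ext (X : quandleType) (A B : xquandleType X) (f g : xhom A B) :
  f =1 g -> f = g.
Proof.
case: f g => f fM fJ [g gM gJ] /= /funext fg; case: _ / fg in gM gJ *.
by rewrite (Prop_irrelevance fM gM) (Prop_irrelevance fJ gJ).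
Qed.

Section XHomMul.
Variables (X : quandleType) (A : xquandleType X) (B : abelianXQuandleType X).
Implicit Types f g : xhom A B.

Lemma xhom_mulM f g : {morph (fun a => f a * g a) : a b / a * b}.
Proof. by move=> a b /=; rewrite !xhomM mulqACA. Qed.

Lemma xhom_mulJ f g (h : As X) (a : A) :
  f (act h a) * g (act h a) = act h (f a * g a).
Proof. by rewrite !xhomJ -actMq. Qed.

Definition xhom_mul f g : xhom A B := XHom (xhom_mulM f g) (xhom_mulJ f g).

HB.instance Definition _ := hasMul.Build (xhom A B) xhom_mul.

End XHomMul.

Record der (Q X : quandleType) (phi : {multiplicative Q -> X})
    (A : xquandleType X) := Der {
  der_fun :> Q -> A;
  derM : forall q1 q2 : Q,
    der_fun (q1 * q2) = der_fun q1 * act (as_map phi (as_gen q1)) (der_fun q2)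
}.

Lemma der_ext (Q X : quandleType) (phi : {multiplicative Q -> X})
  (A : xquandleType X) (f g : der phi A) : f =1 g -> f = g.
Proof.
case: f g => f fM [g gM] /= /funext fg; case: _ / fg in gM *.
by rewrite (Prop_irrelevance fM gM).
Qed.

Section DerMul.
Variables (Q X : quandleType) (phi : {multiplicative Q -> X}).
Variable (A : abelianXQuandleType X).
Implicit Types f g : der phi A.

Lemma der_mulM f g (q1 q2 : Q) :
  f (q1 * q2) * g (q1 * q2) =
  (f q1 * g q1) * act (as_map phi (as_gen q1)) (f q2 * g q2).
Proof. by rewrite !derM mulqACA actMq. Qed.

Definition der_mul f g : der phi A := Der (der_mulM f g).

HB.instance Definition _ := hasMul.Build (der phi A) der_mul.

End DerMul.

(* Terms include the right division [QDiv t u] = the unique [v] with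
   [v * u = t], so that (Q2) becomes equational. *)
Inductive qterm (S : Type) : Type :=
  | QGen of S
  | QMul of qterm S & qterm S
  | QDiv of qterm S & qterm S.

(* The least congruence containing [R] whose quotient is a quandle. *)
Inductive qcong (S : Type) (R : qterm S -> qterm S -> Prop) :
    qterm S -> qterm S -> Prop :=
  | qcong_rel t u : R t u -> qcong R t u
  | qcong_refl t : qcong R t t
  | qcong_sym t u : qcong R t u -> qcong R u t
  | qcong_trans t u v : qcong R t u -> qcong R u v -> qcong R t v
  | qcong_mul t t' u u' :
      qcong R t t' -> qcong R u u' -> qcong R (QMul t u) (QMul t' u')
  | qcong_div t t' u u' :
      qcong R t t' -> qcong R u u' -> qcong R (QDiv t u) (QDiv t' u')
  | qcong_mulqq t : qcong R (QMul t t) t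
  | qcong_divK t u : qcong R (QMul (QDiv t u) u) t
  | qcong_mulK t u : qcong R (QDiv (QMul t u) u) t
  | qcong_mulDl t u v :
      qcong R (QMul (QMul t u) v) (QMul (QMul t v) (QMul u v)).

Section PresentedQuandle.
Variables (S : Type) (R : qterm S -> qterm S -> Prop).

Definition qcongb : rel {classic qterm S} := fun t u => `[< qcong R t u >].

Lemma qcongb_equiv : equiv_class_of qcongb.
Proof.
split=> [t|t u|u t v].
- exact/asboolP/qcong_refl.
- by apply/asboolP/asboolP; apply: qcong_sym.
- by move=> /asboolP tu /asboolP uv; apply/asboolP/(qcong_trans tu uv).
Qed.

Canonical qcongb_equiv_rel := EquivRelPack qcongb_equiv.

Definition presQ : Type := {eq_quot qcongb}.

HB.instance Definition _ := Choice.copy presQ {eq_quot qcongb}.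
HB.instance Definition _ := Quotient.copy presQ {eq_quot qcongb}.

Lemma presQ_eqP (t u : qterm S) :
  \pi_presQ t = \pi_presQ u <-> qcong R t u.
Proof.
split=> [/(@eqmodP _ _ _)/asboolP|tu] //.
exact/eqmodP/asboolP.
Qed.

Lemma presQ_repr (t : qterm S) : qcong R (repr (\pi_presQ t)) t.
Proof. by apply/presQ_eqP; rewrite reprK. Qed.

Definition presQ_mul (x y : presQ) : presQ :=
  \pi_presQ (QMul (repr x) (repr y)).

HB.instance Definition _ := hasMul.Build presQ presQ_mul.

Lemma presQ_mulE (t u : qterm S) :
  (\pi_presQ t) * (\pi_presQ u) = \pi_presQ (QMul t u).
Proof. by apply/presQ_eqP/qcong_mul; exact: presQ_repr. Qed.

Lemma presQ_mulqq (x : presQ) : x * x = x.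
Proof.
by elim/quotW: x => t; rewrite presQ_mulE; apply/presQ_eqP/qcong_mulqq.
Qed.

Lemma presQ_exists1 (x y : presQ) : exists! z, y = z * x.
Proof.
elim/quotW: x => t; elim/quotW: y => u; exists (\pi_presQ (QDiv u t)); split.
  by rewrite presQ_mulE; apply/presQ_eqP/qcong_sym/qcong_divK.
elim/quotW=> v; rewrite presQ_mulE => /presQ_eqP uvt.
apply/presQ_eqP/(@qcong_trans _ _ _ (QDiv (QMul v t) t)).
  exact/qcong_div/qcong_refl.
exact: qcong_mulK.
Qed.

Lemma presQ_mulDl (x y z : presQ) : (x * y) * z = (x * z) * (y * z).
Proof.
elim/quotW: x => t; elim/quotW: y => u; elim/quotW: z => v.
rewrite (presQ_mulE t u) (presQ_mulE t v) (presQ_mulE u v) presQ_mulE.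
by rewrite presQ_mulE; apply/presQ_eqP/qcong_mulDl.
Qed.

End PresentedQuandle.

Section Derived.
Variables (Q X : quandleType) (phi : {multiplicative Q -> X}).

Inductive derived_rel : qterm (As X * Q) -> qterm (As X * Q) -> Prop :=
  | DerivedRel (g : As X) (q1 q2 : Q) :
      derived_rel
        (QGen (g, q1 * q2))
        (QMul (QGen (g, q1)) (QGen (g * as_map phi (as_gen q1), q2))).

Definition derived : Type := presQ derived_rel.

HB.instance Definition _ := Magma.on derived.

Definition derived_gen (g : As X) (q : Q) : derived :=
  \pi_derived (QGen (g, q)).

Lemma derived_inhabited : inhabited derived.
Proof. by case: (@quandle_inhabited Q) => q; exists; exact: derived_gen 1 q. Qed.

HB.instance Definition _ := Magma_isQuandle.Build derived
  derived_inhabited (@presQ_mulqq _ _) (@presQ_exists1 _ _) (@presQ_mulDl _ _).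

Lemma derived_genM (g : As X) (q1 q2 : Q) :
  derived_gen g (q1 * q2) =
  derived_gen g q1 * derived_gen (g * as_map phi (as_gen q1)) q2.
Proof.
rewrite /derived_gen [_ * _ in RHS]presQ_mulE.
exact/presQ_eqP/qcong_rel/DerivedRel.
Qed.

Fixpoint derived_act_term (g : As X) (t : qterm (As X * Q)) :=
  match t with
  | QGen s => QGen (g * s.1, s.2)
  | QMul t u => QMul (derived_act_term g t) (derived_act_term g u)
  | QDiv t u => QDiv (derived_act_term g t) (derived_act_term g u)
  end.

Definition derived_act (g : As X) (x : derived) : derived :=
  \pi_derived (derived_act_term g (repr x)).

Lemma derived_act_cong (g : As X) t u :
  qcong derived_rel t u ->
  qcong derived_rel (derived_act_term g t) (derived_act_term g u).
Proof.
elim=> {t u} /=; try by constructor.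
- move=> t u [h q1 q2] /=; rewrite mulgA; exact/qcong_rel/DerivedRel.
- by move=> t u v _ tu _; apply: qcong_trans.
Qed.

Lemma derived_actE (g : As X) (t : qterm (As X * Q)) :
  derived_act g (\pi_derived t) = \pi_derived (derived_act_term g t).
Proof. exact/presQ_eqP/derived_act_cong/presQ_repr. Qed.

Lemma derived_act1 x : derived_act 1 x = x.
Proof.
elim/quotW: x => t; rewrite derived_actE; congr (\pi_derived _).
by elim: t => [[g q]|t /= -> u ->|t /= -> u ->] //=; rewrite mul1g.
Qed.

Lemma derived_actM g h x :
  derived_act (g * h) x = derived_act g (derived_act h x).
Proof.
elim/quotW: x => t.
rewrite (derived_actE h t) (derived_actE _ t) derived_actE.
congr (\pi_derived _).
by elim: t => [[k q]|t /= -> u ->|t /= -> u ->] //=; rewrite mulgA.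
Qed.

Lemma derived_actMq g : {morph derived_act g : x y / x * y}.
Proof.
elim/quotW=> t; elim/quotW=> u.
rewrite presQ_mulE (derived_actE g t) (derived_actE g u) derived_actE.
by rewrite [RHS]presQ_mulE.
Qed.

HB.instance Definition _ :=
  Quandle_isXQuandle.Build X derived derived_act1 derived_actM derived_actMq.

Lemma derived_act_gen (g h : As X) (q : Q) :
  act g (derived_gen h q) = derived_gen (g * h) q.
Proof. exact: derived_actE. Qed.

(* Hence the product of two maps in [xhom derived A] is the only element of
   [xhom derived A] that is their pointwise product on the generators. *)
Lemma derived_xhom_ext (A : xquandleType X) (f1 f2 : xhom derived A) :
  (forall g q, f1 (derived_gen g q) = f2 (derived_gen g q)) -> f1 = f2.
Proof.
move=> f12; apply: xhom_ext; elim/quotW=> t; elim: t => [[g q]|t ft u fu|t ft u fu]; first exact: f12.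
  by rewrite -presQ_mulE !xhomM ft fu.
have [z [_ zuniq]] := mulq_exists1 (f1 (\pi_derived u)) (f1 (\pi_derived t)).
have tE : \pi_derived t = \pi_derived (QDiv t u) * \pi_derived u.
  by rewrite [_ * _]presQ_mulE; apply/presQ_eqP/qcong_sym/qcong_divK.
rewrite -(zuniq (f1 (\pi_derived (QDiv t u)))) -?xhomM -?tE //.
by apply: zuniq; rewrite ft fu -xhomM -tE.
Qed.

End Derived.

(* Main.v *)
Require Import Defs.
From mathcomp Require Import all_boot.
From HB Require Import structures.
From mathcomp Require Import boolp.

(** Sandwiching a derivation between [sigma] and [tau] gives
    [Phi d = tau \o d \o sigma], whose inverse for bijective [sigma] and [tau]
    is [d |-> tau^-1 \o d \o sigma^-1]. Restriction to the elements [(1, q)]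
    identifies the [X]-homomorphisms out of the derived quandle with the
    derivations, by the universal property, and [tPhi] is [Phi] transported
    along this identification. *)

Set Implicit Arguments.
Unset Strict Implicit.
Unset Printing Implicit Defensive.

Local Open Scope group_scope.
Local Open Scope quotient_scope.

Section RightDivision.
Variable A : quandleType.

(** Choice turns the unique solution in (Q2) into an operation, so that [QDiv] terms can be
    evaluated in any quandle. *)
Definition qdiv (x y : A) : A := sval (cid (mulq_exists1 y x)).

Lemma qdivK (x y : A) : qdiv x y * y = x.
Proof. by rewrite /qdiv; case: cid => z /= []. Qed.

Lemma qmulK (x y : A) : qdiv (x * y) y = x.
Proof. by rewrite /qdiv; case: cid => z /= [_]; apply. Qed.

End RightDivision.

Section PresentedQuandleLift.
Variables (S : Type) (R : qterm S -> qterm S -> Prop).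
Variables (A : quandleType) (f : S -> A).

Fixpoint qeval (t : qterm S) : A :=
  match t with
  | QGen s => f s
  | QMul t u => qeval t * qeval u
  | QDiv t u => qdiv (qeval t) (qeval u)
  end.

Definition presQ_lift (x : presQ R) : A := qeval (repr x).

Hypothesis fR : forall t u, R t u -> qeval t = qeval u.

(** Apart from [R] itself, each rule of [qcong] is an identity valid in every quandle, so [fR]
    suffices for evaluation to descend to the quotient. *)
Lemma qeval_cong t u : qcong R t u -> qeval t = qeval u.
Proof.
elim=> //= {t u}.
- by move=> t u v _ -> _ ->.
- by move=> t t' u u' _ -> _ ->.
- by move=> t t' u u' _ -> _ ->.
- by move=> t; rewrite mulqq.
- by move=> t u; rewrite qdivK.
- by move=> t u; rewrite qmulK.
- by move=> t u v; rewrite mulqDl.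
Qed.

Lemma presQ_liftE (t : qterm S) : presQ_lift (\pi_(presQ R) t) = qeval t.
Proof. exact/qeval_cong/presQ_repr. Qed.

Lemma presQ_liftM : {morph presQ_lift : x y / x * y}.
Proof.
elim/quotW=> t; elim/quotW=> u.
by rewrite presQ_mulE !presQ_liftE.
Qed.

End PresentedQuandleLift.

(** Since [act g] is multiplicative, [act g (qdiv a b) * act g b = act g a], and right division is
    unique. This covers the [QDiv] case of inductions on terms. *)
Lemma act_qdiv (X : quandleType) (A : xquandleType X) (g : As X) (a b : A) :
  act g (qdiv a b) = qdiv (act g a) (act g b).
Proof. by rewrite -[in RHS](qdivK a b) actMq qmulK. Qed.

Section UniversalDerivation.
Variables (Q X : quandleType) (phi : {multiplicative Q -> X}).
Variable A : xquandleType X.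

Section Lift.
Variable d : der phi A.

(** The value is forced by equivariance, as [(g, q)] is the translate by [g] of [(1, q)]. *)
Definition derived_lift_gen (s : As X * Q) : A := act s.1 (d s.2).

Lemma derived_lift_rel t u : derived_rel phi t u ->
  qeval derived_lift_gen t = qeval derived_lift_gen u.
Proof.
by case=> g q1 q2 /=; rewrite /derived_lift_gen /= derM actMq actM.
Qed.

Definition derived_lift_fun : derived phi -> A :=
  presQ_lift (R := derived_rel phi) derived_lift_gen.

Lemma derived_lift_funM : {morph derived_lift_fun : x y / x * y}.
Proof. exact: (presQ_liftM derived_lift_rel). Qed.

Lemma derived_lift_funJ (g : As X) (x : derived phi) :
  derived_lift_fun (act g x) = act g (derived_lift_fun x).
Proof.
elim/quotW: x => t.
rewrite [act g _]derived_actE /derived_lift_fun.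
rewrite !(presQ_liftE derived_lift_rel).
elim: t => [[h q]|t IHt u IHu|t IHt u IHu] /=.
- by rewrite /derived_lift_gen /= actM.
- by rewrite IHt IHu actMq.
- by rewrite IHt IHu act_qdiv.
Qed.

Definition derived_lift : xhom (derived phi) A :=
  XHom derived_lift_funM derived_lift_funJ.

Lemma derived_liftE (g : As X) (q : Q) :
  derived_lift (derived_gen phi g q) = act g (d q).
Proof. exact: (presQ_liftE derived_lift_rel). Qed.

End Lift.

Section Restriction.
Variable l : xhom (derived phi) A.

(** The defining relation at [g = 1] has second factor [(phi(e_q1), q2)], the translate of [(1, q2)]
    by [phi(e_q1)]; equivariance of [l] moves this translation outside. *)
Lemma xhom_derM (q1 q2 : Q) :
  l (derived_gen phi 1 (q1 * q2)) =
  l (derived_gen phi 1 q1)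
    * act (as_map phi (as_gen q1)) (l (derived_gen phi 1 q2)).
Proof. by rewrite derived_genM xhomM -xhomJ derived_act_gen mulg1 mul1g. Qed.

Definition xhom_der : der phi A := Der xhom_derM.

End Restriction.

Lemma derived_liftK : cancel derived_lift xhom_der.
Proof.
move=> d; apply: der_ext => q.
exact: etrans (derived_liftE d 1 q) (act1 _).
Qed.

Lemma xhom_derK : cancel xhom_der derived_lift.
Proof.
move=> l; apply: derived_xhom_ext => g q.
by rewrite derived_liftE /= -xhomJ derived_act_gen mulg1.
Qed.

End UniversalDerivation.

Section UniversalDerivationMul.
Variables (Q X : quandleType) (phi : {multiplicative Q -> X}).
Variable A : abelianXQuandleType X.

Lemma xhom_der_is_multiplicative :
  {morph @xhom_der Q X phi A : l1 l2 / l1 * l2}.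
Proof. by move=> l1 l2; apply: der_ext. Qed.

(** The inverse of a multiplicative bijection is multiplicative. *)
Lemma derived_lift_is_multiplicative :
  {morph @derived_lift Q X phi A : d1 d2 / d1 * d2}.
Proof.
move=> d1 d2; apply: (can_inj (@xhom_derK Q X phi A)).
by rewrite xhom_der_is_multiplicative !derived_liftK.
Qed.

HB.instance Definition _ := isMultiplicative.Build
  (xhom (derived phi) A) (der phi A) (@xhom_der Q X phi A)
  xhom_der_is_multiplicative.
HB.instance Definition _ := isMultiplicative.Build
  (der phi A) (xhom (derived phi) A) (@derived_lift Q X phi A)
  derived_lift_is_multiplicative.

End UniversalDerivationMul.

Section DerivationMap.
Variables (Q1 X1 Q2 X2 : quandleType).
Variables (phi1 : {multiplicative Q1 -> X1}) (phi2 : {multiplicative Q2 -> X2}).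
Variables (sigma : {multiplicative Q2 -> Q1}) (psi : {multiplicative X1 -> X2}).
Hypothesis comm : psi \o phi1 \o sigma =1 phi2.

(** On the restricted quandle [e_x] acts as [e_(psi x)], and [comm] gives
    [psi (phi1 (sigma q)) = phi2 q]. *)
Lemma xhom_act_comm (A1 : xquandleType X1) (A2 : xquandleType X2)
    (tau : xhom A1 (restrict psi A2)) (q : Q2) (a : A1) :
  tau (act (as_map phi1 (as_gen (sigma q))) a) =
  act (as_map phi2 (as_gen q)) (tau a : A2).
Proof.
rewrite xhomJ; congr (act _ (tau a : A2)).
by rewrite !as_mapE -comm.
Qed.

Variables (A1 : abelianXQuandleType X1) (A2 : abelianXQuandleType X2).
Variable tau : xhom A1 (restrict psi A2).

Lemma der_map_derM (d : der phi1 A1) (q1 q2 : Q2) :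
  (tau (d (sigma (q1 * q2))) : A2) =
  (tau (d (sigma q1)) : A2)
    * act (as_map phi2 (as_gen q1)) (tau (d (sigma q2)) : A2).
Proof. by rewrite gmulfM derM xhomM xhom_act_comm. Qed.

Definition der_map (d : der phi1 A1) : der phi2 A2 := Der (der_map_derM d).

Lemma der_map_is_multiplicative : {morph der_map : d1 d2 / d1 * d2}.
Proof.
move=> d1 d2; apply: der_ext => q.
exact: (xhomM tau (d1 (sigma q)) (d2 (sigma q))).
Qed.

HB.instance Definition _ := isMultiplicative.Build
  (der phi1 A1) (der phi2 A2) der_map der_map_is_multiplicative.

Lemma der_map_bij : bijective sigma -> bijective tau -> bijective der_map.
Proof.
case=> sigma' sigmaK sigmaK' [tau' tauK tauK'].
have derM' (d : der phi2 A2) (q1 q2 : Q1) :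
    tau' (d (sigma' (q1 * q2))) =
    tau' (d (sigma' q1))
      * act (as_map phi1 (as_gen q1)) (tau' (d (sigma' q2))).
  (* Writing [q1] and [q2] as images under [sigma] lets [sigma'] pass through the product and brings
     the action into the form required by [xhom_act_comm]. *)
  rewrite -{1 3}(sigmaK' q1) -{1}(sigmaK' q2) -gmulfM sigmaK.
  (* Applying the injective [tau] to both sides leaves the derivation law of [d]. *)
  by apply: (can_inj tauK); rewrite xhomM xhom_act_comm !tauK' derM.
exists (fun d => Der (derM' d)) => d; apply: der_ext => q /=.
- by rewrite tauK sigmaK'.
- by rewrite tauK' sigmaK.
Qed.

End DerivationMap.

Theorem theorem4p6
  (Q1 X1 Q2 X2 : quandleType)
  (phi1 : {multiplicative Q1 -> X1}) (phi2 : {multiplicative Q2 -> X2})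
  (sigma : {multiplicative Q2 -> Q1}) (psi : {multiplicative X1 -> X2})
  (comm : psi \o phi1 \o sigma =1 phi2)
  (A1 : abelianXQuandleType X1) (A2 : abelianXQuandleType X2)
  (tau : xhom A1 (restrict psi A2)) :
  exists (Phi : {multiplicative der phi1 A1 -> der phi2 A2})
         (tPhi : {multiplicative xhom (derived phi1) A1
                                 -> xhom (derived phi2) A2}),
    bijective psi -> bijective sigma -> bijective tau ->
    bijective Phi /\ bijective tPhi.
Proof.
exists (der_map comm tau : {multiplicative _ -> _}).
exists (@derived_lift _ _ phi2 A2 \o (der_map comm tau \o @xhom_der _ _ phi1 A1)
  : {multiplicative _ -> _}).
move=> _ sigma_bij tau_bij.
have Phi_bij := der_map_bij comm sigma_bij tau_bij.
(* [tPhi] is [Phi] composed on either side with a bijection from the universal property. *)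
split=> //; apply: bij_comp.
  by exists (@xhom_der _ _ phi2 A2); [apply: derived_liftK | apply: xhom_derK].
apply: (bij_comp Phi_bij).
by exists (@derived_lift _ _ phi1 A1); [apply: xhom_derK | apply: derived_liftK].
Qed.
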